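(* For every integer $m \ge 2$, $d(m, 4m+1) \le 1260$.
   Context: An integral point set in $\mathbb{R}^m$ is a finite set $\mathcal{P}$ of points of the $m$-dimensional Euclidean space $\mathbb{R}^m$ such that the Euclidean distance between any two points of $\mathcal{P}$ is an integer and $\mathcal{P}$ is not contained in an $(m-1)$-dimensional (affine) hyperplane. Its diameter is $\operatorname{diam}(\mathcal{P}) = \max_{P_1, P_2 \in \mathcal{P}} |P_1P_2|$. The function $d(m,n)$ is the minimal possible diameter of an integral point set of $n$ points in $\mathbb{R}^m$. *)

(* Defs.v *)
From mathcomp Require Import all_boot all_order all_algebra.
From mathcomp Require Import finmap reals.

Set Implicit Arguments.
Unset Strict Implicit.
Unset Printing Implicit Defensive.

Import Order.TTheory GRing.Theory Num.Theory.

Local Open Scope ring_scope.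

(* Points of R^m are row vectors.  The norm that MathComp-Analysis puts on
   'rV[R]_m is the sup norm, hence the explicit Euclidean distance. *)
Definition edist (R : realType) (m : nat) (x y : 'rV[R]_m) : R :=
  Num.sqrt (\sum_(i < m) (x 0 i - y 0 i) ^+ 2).

(* P is contained in p + V for some point p and some linear subspace V of
   dimension m - 1; the equation is written without truncated subtraction. *)
Definition in_hyperplane (R : realType) (m : nat) (P : {fset 'rV[R]_m}) : Prop :=
  exists (p : 'rV[R]_m) (V : {vspace 'rV[R]_m}),
    (\dim V).+1 = m /\ (forall x, x \in P -> x - p \in V).

Definition integral_point_set (R : realType) (m : nat)
    (P : {fset 'rV[R]_m}) : Prop :=
  (forall x y, x \in P -> y \in P -> edist x y \is a Num.int) /\
  ~ in_hyperplane P.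

(* Distances are nonnegative, so the default value 0 only matters for the
   empty set. *)
Definition diam (R : realType) (m : nat) (P : {fset 'rV[R]_m}) : R :=
  \big[Num.max/0]_(x <- P) \big[Num.max/0]_(y <- P) edist x y.

(* "d(m, n) = d": d is the least diameter of an integral point set
   of n points in R^m, and is attained.  A relation is used because d(m, n) is
   undefined when there is no such set (for instance when 1 <= n <= m). *)
Definition is_min_diam (R : realType) (m n : nat) (d : R) : Prop :=
  (exists P : {fset 'rV[R]_m},
     [/\ integral_point_set P, #|` P|%fset = n & diam P = d]) /\
  (forall P : {fset 'rV[R]_m},
     integral_point_set P -> #|` P|%fset = n -> d <= diam P).

(* Main.v *)
(* Take m vectors of length 4 with pairwise inner product 7/2 (one always finds
   them in R^m) and put on the line spanned by each of them its multiples by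
   k in {-63, -44, -12, 33}; add the origin.  Points on one line are at distance
   4|k - l|, points on two lines at distance sqrt(16 k^2 + 16 l^2 - 7 k l), which
   is an integer for all these k, l.  The 4m + 1 points have diameter at most
   384.  The minimum d(m, n) is attained because diameters of integral point
   sets are natural numbers.  The four multiples were found by a computer
   search. *)

Require Import Defs.
From mathcomp Require Import all_boot all_order all_algebra.
From mathcomp Require Import finmap boolp reals.
From mathcomp Require Import ring lra.

Set Implicit Arguments.
Unset Strict Implicit.
Unset Printing Implicit Defensive.

Import Order.TTheory GRing.Theory Num.Theory.

Local Open Scope ring_scope.

(** * Diameters and attainment of the minimum *)

Lemma diam_ind (R : realType) (m : nat) (K : R -> Prop) (P : {fset 'rV[R]_m}) :
  K 0 -> (forall x y, x \in P -> y \in P -> K (edist x y)) -> K (diam P).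
Proof.
move=> K0 KP.
(* A maximum is one of its two arguments, so [K] passes through both iterated maxima; [K 0] serves
   their default value. *)
have Kmax a b : K a -> K b -> K (Num.max a b).
  by move=> Ka Kb; rewrite /Order.max; case: ifP.
rewrite /diam big_seq; elim/big_ind: _ => // x xP.
by rewrite big_seq; elim/big_ind: _ => // y yP; apply: KP.
Qed.

Lemma integral_diam_nat (R : realType) (m : nat) (P : {fset 'rV[R]_m}) :
  integral_point_set P -> diam P \is a Num.nat.
Proof.
move=> [intP _]; apply: (@diam_ind _ _ (fun d => d \is a Num.nat)).
  exact: rpred0.
by move=> x y xP yP; rewrite natrEint intP //= sqrtr_ge0.
Qed.

Lemma min_diam_exists (R : realType) (m n : nat) (P : {fset 'rV[R]_m}) :
  integral_point_set P -> #|` P|%fset = n ->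
  exists2 d : R, is_min_diam m n d & d <= diam P.
Proof.
move=> iP cP.
(* Made boolean, so that [ex_minnP] yields the least attained diameter. *)
pose A (k : nat) := `[< exists Q : {fset 'rV[R]_m},
  [/\ integral_point_set Q, #|` Q|%fset = n & diam Q = k%:R] >].
have AE (Q : {fset 'rV[R]_m}) : integral_point_set Q -> #|` Q|%fset = n ->
    exists2 k, A k & diam Q = k%:R.
  move=> iQ cQ; have /natrP[k dQ] := integral_diam_nat iQ.
  by exists k => //; apply/asboolP; exists Q.
have exA : exists k, A k by have [k Ak _] := AE _ iP cP; exists k.
case: (ex_minnP exA) => k /asboolP Ak kmin; exists k%:R; last first.
  by have [j Aj ->] := AE _ iP cP; rewrite ler_nat kmin.
split=> // Q iQ cQ.
by have [j Aj ->] := AE _ iQ cQ; rewrite ler_nat kmin.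
Qed.

(** * The legs: distances and span *)

Section Spider.

Variables (R : realType) (m : nat).

(* The legs a e_i + b (1,...,1) have length 4 and pairwise inner product 7/2:
   a and b solve a^2 = 25/2 and 2ab + m b^2 = 7/2. *)
Let a : R := Num.sqrt (25 / 2).
Let b : R := (Num.sqrt (25 / 2 + 7 / 2 * m%:R) - a) / m%:R.

Definition leg (i : 'I_m) : 'rV[R]_m := a *: delta_mx 0 i + const_mx b.

Let sqr_a : a ^+ 2 = 25 / 2.
Proof. by rewrite sqr_sqrtr //; lra. Qed.

Let abm_sqr : (0 < m)%N -> (a + m%:R * b) ^+ 2 = 25 / 2 + 7 / 2 * m%:R.
Proof.
move=> m0; rewrite /b mulrC divfK ?pnatr_eq0 -?lt0n // subrKC sqr_sqrtr //.
have : 0 <= m%:R :> R by [].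
lra.
Qed.

Let abm : (0 < m)%N -> 2 * a * b + m%:R * b ^+ 2 = 7 / 2.
Proof.
move=> m0; have mR : m%:R != 0 :> R by rewrite pnatr_eq0 -lt0n.
(* Multiplied by [m], the left side is [(a + m b)^2 - a^2]. *)
apply: (mulfI mR); have := abm_sqr m0.
rewrite sqrrD sqr_a => h.
have -> : m%:R * (7 / 2) = 25 / 2 + 7 / 2 * m%:R - 25 / 2 :> R by ring.
by rewrite -h; ring.
Qed.

Lemma sum_sqr_leg (i j : 'I_m) (k l : R) :
  \sum_(t < m) ((k *: leg i) 0 t - (l *: leg j) 0 t) ^+ 2 =
  if i == j then 16 * (k - l) ^+ 2 else 16 * k ^+ 2 + 16 * l ^+ 2 - 7 * k * l.
Proof.
have m0 : (0 < m)%N by apply: leq_ltn_trans (ltn_ord i).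
have sumd (r : 'I_m) : \sum_(t < m) (t == r)%:R = 1 :> R.
  by rewrite (bigD1 r) //= eqxx big1 ?addr0 // => t /negPf ->.
pose d (r t : 'I_m) : R := (t == r)%:R.
have dd r t : d r t * d r t = d r t by rewrite /d; case: eqP; rewrite ?mulr1 ?mulr0.
have dij t : d i t * d j t = (i == j)%:R * d i t.
  rewrite /d; have [->|_] := eqVneq t i; last by rewrite mul0r mulr0.
  by rewrite mul1r mulr1.
(* The rules [dd] and [dij] for products of Kronecker deltas make each summand affine in [d i t] and
   [d j t]. *)
transitivity (\sum_(t < m) ((a ^+ 2 * k ^+ 2 + 2 * a * b * k * (k - l)
    - 2 * a ^+ 2 * k * l * (i == j)%:R) * d i t +
  (a ^+ 2 * l ^+ 2 - 2 * a * b * l * (k - l)) * d j t + b ^+ 2 * (k - l) ^+ 2)).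
  apply: eq_bigr => t _; rewrite !mxE eqxx /= -/(d i t) -/(d j t).
  transitivity (a ^+ 2 * k ^+ 2 * (d i t * d i t) + a ^+ 2 * l ^+ 2 * (d j t * d j t)
    - 2 * a ^+ 2 * k * l * (d i t * d j t) + 2 * a * b * (k - l) * (k * d i t - l * d j t)
    + b ^+ 2 * (k - l) ^+ 2); first by ring.
  by rewrite !dd dij; ring.
rewrite !big_split /= -!mulr_sumr !sumd sumr_const card_ord !mulr1 -mulr_natl.
transitivity (a ^+ 2 * (k ^+ 2 + l ^+ 2 - 2 * k * l * (i == j)%:R)
  + (2 * a * b + m%:R * b ^+ 2) * (k - l) ^+ 2); first by ring.
by rewrite abm // sqr_a; case: eqP => _ /=; field.
Qed.

(** The legs sum to a nonzero multiple of the all-ones vector; subtracting [b] times that vector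
    from a leg leaves a nonzero multiple of a unit vector. *)
Lemma span_leg (V : {vspace 'rV[R]_m}) :
  (0 < m)%N -> (forall i, leg i \in V) -> \dim V = m.
Proof.
move=> m0 legV.
have a0 : a != 0 by rewrite -sqrf_eq0 sqr_a; apply: lt0r_neq0; lra.
have c0 : a + m%:R * b != 0.
  rewrite -sqrf_eq0 abm_sqr //; apply: lt0r_neq0.
  have : 0 <= m%:R :> R by [].
  lra.
have sumleg : \sum_i leg i = (a + m%:R * b) *: const_mx 1.
  apply/rowP => t; rewrite summxE !mxE mulr1.
  under eq_bigr do rewrite !mxE eqxx /=.
  rewrite big_split /= -mulr_sumr sumr_const card_ord mulr_natl.
  rewrite (bigD1 t) //= eqxx big1 ?addr0 ?mulr1 // => i /negPf.
  by rewrite eq_sym => ->.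
have oneV : const_mx 1 \in V.
  have : \sum_i leg i \in V by apply: rpred_sum.
  by rewrite sumleg rpredZeq (negPf c0).
have deltaV i : delta_mx 0 i \in V.
  have /(rpredB (legV i)) : b *: const_mx 1 \in V by rewrite rpredZ.
  rewrite /leg scalemx_const mulr1 addrK.
  by rewrite rpredZeq (negPf a0).
have -> : V = fullv.
  apply/vspaceP => x; rewrite memvf (row_sum_delta x).
  by apply: rpred_sum => i _; apply: rpredZ.
by rewrite dimvf /dim /= mul1n.
Qed.

(** * The point set on the legs *)

Definition radii : seq R := [:: -63; -44; -12; 33].

Definition spider : {fset 'rV[R]_m} :=
  [fset x in 0 :: [seq k *: leg i | i <- enum 'I_m, k <- radii]]%fset.

Lemma radii_sqr_dist (k l : R) : k \in 0 :: radii -> l \in 0 :: radii ->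
  exists2 n : nat, (n <= 384)%N &
    16 * k ^+ 2 + 16 * l ^+ 2 - 7 * k * l = n%:R ^+ 2.
Proof.
rewrite !inE => /or4P[|||/orP[]] /eqP-> /or4P[|||/orP[]] /eqP->;
  (* Of the candidate roots, the one for which [ring] succeeds is taken; the radius 0 stands for the
     origin. *)
  first [ exists 0%N; [by []|ring] | exists 48%N; [by []|ring]
        | exists 60%N; [by []|ring] | exists 132%N; [by []|ring]
        | exists 150%N; [by []|ring] | exists 165%N; [by []|ring]
        | exists 172%N; [by []|ring] | exists 176%N; [by []|ring]
        | exists 220%N; [by []|ring] | exists 242%N; [by []|ring]
        | exists 246%N; [by []|ring] | exists 252%N; [by []|ring]
        | exists 274%N; [by []|ring] | exists 309%N; [by []|ring]
        | exists 315%N; [by []|ring] ].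
Qed.

(** The largest root is 384 = 4 (33 + 63). *)
Lemma radii_sub (k l : R) : k \in 0 :: radii -> l \in 0 :: radii ->
  exists2 n : nat, (n <= 384)%N & 16 * (k - l) ^+ 2 = n%:R ^+ 2.
Proof.
rewrite !inE => /or4P[|||/orP[]] /eqP-> /or4P[|||/orP[]] /eqP->;
  first [ exists 0%N; [by []|ring] | exists 48%N; [by []|ring]
        | exists 76%N; [by []|ring] | exists 128%N; [by []|ring]
        | exists 132%N; [by []|ring] | exists 176%N; [by []|ring]
        | exists 180%N; [by []|ring] | exists 204%N; [by []|ring]
        | exists 252%N; [by []|ring] | exists 308%N; [by []|ring]
        | exists 384%N; [by []|ring] ].
Qed.

Lemma uniq_radii : uniq radii.
Proof.
rewrite /= !inE !negb_or !andbT.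
by repeat (apply/andP; split); apply/eqP => h; lra.
Qed.

Lemma radii_neq0 k : k \in radii -> k != 0.
Proof. by rewrite !inE => /or4P[] /eqP->; apply/eqP => h; lra. Qed.

Lemma edist_leg (i j : 'I_m) (k l : R) : k \in 0 :: radii -> l \in 0 :: radii ->
  exists2 n : nat, (n <= 384)%N & edist (k *: leg i) (l *: leg j) = n%:R.
Proof.
move=> kS lS; rewrite /edist sum_sqr_leg.
have [n n384 ->] : exists2 n : nat, (n <= 384)%N &
    (if i == j then 16 * (k - l) ^+ 2
     else 16 * k ^+ 2 + 16 * l ^+ 2 - 7 * k * l) = n%:R ^+ 2.
  by case: eqP => _; [apply: radii_sub | apply: radii_sqr_dist].
by exists n; rewrite // sqrtr_sqr normr_nat.
Qed.

Lemma leg_inj (i j : 'I_m) (k l : R) : k != 0 ->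
  k *: leg i = l *: leg j -> i = j /\ k = l.
Proof.
move=> k0 e; have := sum_sqr_leg i j k l; rewrite e.
rewrite big1 => [|t _]; last by rewrite subrr expr0n.
have k2 : 0 < k ^+ 2 by rewrite exprn_even_gt0.
(* On distinct legs the squared distance is a positive definite form in [k] and [l], so it cannot
   vanish with [k != 0]. *)
case: eqP => [->|_] h; last by nra.
by split=> //; apply/eqP; rewrite -subr_eq0 -sqrf_eq0; apply/eqP; lra.
Qed.

Lemma mem_spider (x : 'rV[R]_m) : (0 < m)%N -> x \in spider ->
  exists (i : 'I_m) (k : R), k \in 0 :: radii /\ x = k *: leg i.
Proof.
move=> m0; rewrite in_fset inE => /predU1P[->|].
  by exists (Ordinal m0), 0; rewrite scale0r mem_head.
by move=> /allpairsP[[i k] /= [_ kS ->]]; exists i, k; rewrite inE kS orbT.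
Qed.

Lemma spider_dist (x y : 'rV[R]_m) : (0 < m)%N -> x \in spider -> y \in spider ->
  exists2 n : nat, (n <= 384)%N & edist x y = n%:R.
Proof.
move=> m0 /(mem_spider m0)[i [k [kS ->]]] /(mem_spider m0)[j [l [lS ->]]].
exact: edist_leg.
Qed.

Lemma card_spider : #|` spider|%fset = (4 * m + 1)%N.
Proof.
(* The count is the length of the list once the list is known to be free of repetitions. *)
rewrite card_fseq undup_id.
  by rewrite -cat1s size_cat size_allpairs size_enum_ord mulnC addnC.
rewrite cons_uniq; apply/andP; split.
  apply/negP => /allpairsP[[i k] /= [_ kS e]].
  have k0 := radii_neq0 kS; have := esym e; rewrite -[RHS](scale0r (leg i)).
  by move=> /(leg_inj k0)[_ /eqP]; rewrite (negPf k0).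
apply: allpairs_uniq; rewrite ?enum_uniq ?uniq_radii //.
move=> [i k] [j l] /allpairsP[[i1 k1] /= [_ kS [-> ->]]] _ e.
by have [-> ->] := leg_inj (radii_neq0 kS) e.
Qed.

Lemma integral_spider : (0 < m)%N -> integral_point_set spider.
Proof.
move=> m0; split=> [x y xP yP|].
  by have [n _ ->] := spider_dist m0 xP yP; rewrite natr_int.
move=> [p [V [dimV PV]]].
(* The origin belongs to the set, so the affine subspace [p + V] is [V] itself. *)
have pV : p \in V.
  have : 0 - p \in V by apply: PV; rewrite in_fset mem_head.
  by rewrite sub0r rpredN.
suff : \dim V = m by move: dimV => /[swap] -> /eqP; rewrite eqn_leq ltnn.
apply: span_leg => // i.
(* One nonzero multiple on each line puts every leg in [V], against the dimension [m - 1]. *)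
have : (33 : R) *: leg i \in V.
  rewrite -[X in X \in V](subrK p) rpredD // PV // in_fset inE.
  apply/orP; right; apply/allpairsP; exists (i, 33).
  by rewrite /= mem_enum !inE eqxx !orbT.
by rewrite rpredZeq pnatr_eq0.
Qed.

Lemma diam_spider : (0 < m)%N -> diam spider <= 384.
Proof.
move=> m0; apply: (@diam_ind _ _ (fun d => d <= 384)) => // x y xP yP.
by have [n n384 ->] := spider_dist m0 xP yP; rewrite ler_nat.
Qed.

End Spider.

Theorem mainTheorem6 (R : realType) (m : nat) (hm : (2 <= m)%N) :
  exists2 d : R, is_min_diam m (4 * m + 1)%N d & d <= 1260.
Proof.
have m0 : (0 < m)%N by apply: leq_trans hm.
have [d dmin dle] :=
  min_diam_exists (integral_spider R m0) (card_spider R m).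
exists d => //; apply: le_trans dle _; apply: le_trans (diam_spider R m0) _.
by rewrite ler_nat.
Qed.
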